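(* Let $K \subset [0,1]$ be the middle-third Cantor set, let $\gamma = \frac{\log 2}{\log 3}$, and let $\mu$ be the natural probability measure on $K$, namely the Hausdorff $\gamma$-measure restricted to $K$. For $\tau \ge 0$ define $\psi_\tau(n) = n^{-\tau}$ for $n \in \mathbb{N}$. For $y \in \mathbb{R}$ let \[ W_2(\psi_\tau, y) = \{ x \in \mathbb{R} : \| 2^n x - y \| < \psi_\tau(n) \text{ for infinitely many } n \in \mathbb{N} \}, \] where $\|t\|$ denotes the distance from $t \in \mathbb{R}$ to the nearest integer. If $\tau \ge 1/\gamma - 0.01$ and $y \in \mathbb{R}$, then $\mu(W_2(\psi_\tau, y)) = 0$.
   Context: $K$ consists of the real numbers $x\in[0,1]$ having a ternary expansion using only the digits $0$ and $2$; its Hausdorff dimension is $\gamma=\log 2/\log 3$, and $\mathcal{H}^\gamma(K)=1$, so $\mu$ is a probability measure. *)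

(* Defs.v *)
From HB Require Import structures.
From mathcomp Require Export all_boot all_order all_algebra.
From mathcomp Require Export all_classical all_reals all_analysis.
Import Order.TTheory GRing.Theory Num.Theory.
Import numFieldNormedType.Exports.
Set Implicit Arguments.
Unset Strict Implicit.
Unset Printing Implicit Defensive.
Local Open Scope classical_set_scope.
Local Open Scope ring_scope.

Section HausdorffMeasure.
Variable R : realType.
Local Open Scope ereal_scope.

(* The point 0 is thrown in so that the diameter of the empty set is 0 and
   not ereal_sup set0 = -oo; it does not change the other diameters. *)
Definition diam (U : set R) : \bar R :=
  ereal_sup ([set 0] `|` [set (`|x - y|%R)%:E | x in U & y in U]).

(* The term |U|^s, with the usual convention |set0|^s = 0 (which matters only
   for s = 0, as 0 `^ 0 = 1). *)
Definition diam_pow (s : R) (U : set R) : \bar R :=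
  if U == set0 then 0 else diam U `^ s.

Definition delta_cover (delta : R) (A : set R) (U : nat -> set R) : Prop :=
  (forall i, diam (U i) <= delta%:E) /\ A `<=` \bigcup_i U i.

Definition hausdorff_delta (s delta : R) (A : set R) : \bar R :=
  ereal_inf [set \sum_(0 <= i <oo) diam_pow s (U i) |
             U in [set U : nat -> set R | delta_cover delta A U]].

Definition hausdorff (s : R) (A : set R) : \bar R :=
  ereal_sup [set hausdorff_delta s delta A |
             delta in [set delta : R | (0 < delta)%R]].

End HausdorffMeasure.

Section Cantor.
Variable R : realType.

Definition cantor_set : set R :=
  [set x : R | 0 <= x <= 1 /\
    exists d : nat -> nat,
      (forall i, d i = 0%N \/ d i = 2%N) /\
      series (fun i => (d i)%:R / 3 ^+ i.+1 : R) @ \oo --> x].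

Definition cantor_dim : R := ln 2 / ln 3.

Definition cantor_measure (A : set R) : \bar R :=
  hausdorff cantor_dim (A `&` cantor_set).

Definition dist_int (t : R) : R := inf [set `|t - k%:~R| | k in [set: int]].

Definition psi (tau : R) (n : nat) : R := n%:R `^ (- tau).

Definition W2 (f : nat -> R) (y : R) : set R :=
  [set x : R | infinite_set
    [set n : nat | (0 < n)%N /\ dist_int (2 ^+ n * x - y) < f n]].

End Cantor.

Arguments cantor_dim R : clear implicits.
Arguments cantor_set R : clear implicits.

(* Main.v *)
Require Import Defs.
From mathcomp Require Import zify lra ring.
Import Order.TTheory GRing.Theory Num.Theory.
Import numFieldNormedType.Exports.
Set Implicit Arguments.
Unset Strict Implicit.
Unset Printing Implicit Defensive.

(**
A point of K lies in one of the level-L intervals [2b/3^L, (2b+1)/3^L], where b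
has ternary digits 0 and 1, and such an interval has diam^gamma = 2^-L.  Take
729^s <= n < 729^(s+1), so that psi_tau(n) <= n^(-3/2) <= 3^(-9s) because
ln 3 / ln 2 - 1/100 >= 3/2, let 3^l be the least power of 3 with 2^n <= 3^l, and
let L = l + 9s.  The intervals of level L that meet
{x : ||2^n x - y|| < 3^(-9s)} are those for which 2^(n+1) b mod 3^L falls in
a window of length O(3^l).

- The last 8s digits of b are determined by the others up to O(1) choices.
- The remaining prefix has to bring 2^(n+1) b / 3^(l+s) within O(3^-s) of a
  given point of the circle.  The digits in positions (2s, 4s] and (4s, 6s]
  contribute two summands h a_1 / 3^(4s) and h a_2 / 3^(6s), h = 2^(n+1), and
  by Cauchy-Schwarz the number of admissible pairs (a_1, a_2) is bounded by the
  numbers of collisions of each summand at scale 3^-s, uniformly in the other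
  digits.
- Since 2 has order 2 * 3^(q-1) modulo 3^q, averaging over the block of n makes
  each difference h (a - a') / 3^Q equidistributed at scale 3^-s, so that the
  average number of collisions is O(16^s 3^-s).

Altogether the cover belonging to the block s has gamma-weight O((243/256)^s),
which is summable.
*)

(** * Naturals with ternary digits 0 and 1 *)

Fixpoint codes (L : nat) : seq nat :=
  if L is L'.+1 then flatten [seq [:: 3 * b; 3 * b + 1] | b <- codes L'] else [:: 0].

Lemma codesS_mem L b e : b \in codes L -> e <= 1 -> 3 * b + e \in codes L.+1.
Proof.
move=> bL e1; apply/flatten_mapP; exists b => //.
by case: e e1 => [|[|//]] _; rewrite !inE ?addn0 eqxx ?orbT.
Qed.

Lemma sum_codesS L (F : nat -> nat) :
  \sum_(b <- codes L.+1) F b = \sum_(b <- codes L) (F (3 * b) + F (3 * b + 1)).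
Proof.
rewrite /= big_flatten big_map; apply: eq_bigr => b _.
by rewrite big_cons big_seq1.
Qed.

Lemma sum_codesD L1 L2 (F : nat -> nat) :
  \sum_(b <- codes (L1 + L2)) F b =
  \sum_(b1 <- codes L1) \sum_(b2 <- codes L2) F (b1 * 3 ^ L2 + b2).
Proof.
elim: L2 F => [|L2 IH] F.
  by rewrite addn0; apply: eq_bigr => b _; rewrite /= big_seq1 expn0 muln1 addn0.
rewrite addnS sum_codesS IH; apply: eq_bigr => b1 _; rewrite sum_codesS.
by apply: eq_bigr => b2 _; congr (F _ + F _); rewrite expnS; lia.
Qed.

Lemma size_codes L : size (codes L) = 2 ^ L.
Proof.
rewrite -sum1_size; elim: L => [|L IH]; first by rewrite big_seq1.
by rewrite sum_codesS expnS -IH big_distrr.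
Qed.

Lemma codes_lt L b : b \in codes L -> b < 3 ^ L.
Proof.
elim: L b => [|L IH] b; first by rewrite inE => /eqP ->.
by case/flatten_mapP => b' /IH; rewrite expnS !inE => lt /orP[]/eqP->; lia.
Qed.

Lemma codes_uniq L : uniq (codes L).
Proof.
elim: L => //= L; elim: (codes L) => //= b r IH /andP[bNr ur].
rewrite IH // andbT inE negb_or.
have nb e : e <= 1 -> 3 * b + e \notin flatten [seq [:: 3 * b'; 3 * b' + 1] | b' <- r].
  move=> e1; apply/flatten_mapP => -[b' b'r]; rewrite !inE => h.
  have E : b = b' by case/orP: h => /eqP; lia.
  by rewrite E b'r in bNr.
have := nb 0 isT; rewrite addn0 => ->; rewrite nb // !andbT.
by apply/eqP; lia.
Qed.

(** * Elementary counting on codes *)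

Lemma leq_count_inj (r : seq nat) (p : pred nat) (T : eqType) (f : nat -> T) (t : seq T) :
  uniq r -> {in [seq b <- r | p b] &, injective f} ->
  (forall b, b \in r -> p b -> f b \in t) ->
  \sum_(b <- r) p b <= size t.
Proof.
move=> ur finj ft.
have -> : \sum_(b <- r) p b = size [seq f b | b <- [seq b <- r | p b]].
  rewrite size_map size_filter -sum1_count [RHS]big_mkcond /=.
  by apply: eq_bigr => b _; case: (p b).
apply: uniq_leq_size; first by rewrite map_inj_in_uniq // filter_uniq.
move=> x /mapP[b + ->]; rewrite mem_filter => /andP[pb br]; exact: ft.
Qed.

(* The progression runs over less than one period, so it wraps around at most once. *)
Lemma count_codes_window N X h P W : 0 < h -> h * 3 ^ N <= P ->
  \sum_(b <- codes N) ((X + h * b) %% P <= W) <= 2 * (W %/ h).+1.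
Proof.
move=> h0 hP.
have P0 : 0 < P by apply: leq_trans hP; rewrite muln_gt0 h0 expn_gt0.
(* The first entry counts wraps past a multiple of [P], the second is the length-[h] block holding
   the residue. If both agree for [b] and [b'], then [h * b] and [h * b'] differ by less than [h],
   so [b = b']. *)
pose f b := ((X + h * b) %/ P - X %/ P, ((X + h * b) %% P) %/ h).
pose t := [seq (i, j) | i <- iota 0 2, j <- iota 0 (W %/ h).+1].
have -> : 2 * (W %/ h).+1 = size t by rewrite size_allpairs !size_iota.
apply: (@leq_count_inj _ (fun b => (X + h * b) %% P <= W) _ f); first exact: codes_uniq.
- move=> b b'; rewrite !mem_filter => /andP[_ bN] /andP[_ b'N] [E1 E2].
  have le x : X %/ P <= (X + x) %/ P by rewrite leq_div2r // leq_addr.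
  have {}E1 : (X + h * b) %/ P = (X + h * b') %/ P.
    by move: E1 (le (h * b)) (le (h * b')); lia.
  have := divn_eq (X + h * b) P; have := divn_eq (X + h * b') P; rewrite E1.
  move: (divn_eq ((X + h * b) %% P) h) (divn_eq ((X + h * b') %% P) h); rewrite E2.
  have := ltn_pmod ((X + h * b) %% P) h0; have := ltn_pmod ((X + h * b') %% P) h0.
  move=> m1 m2 -> -> d1 d2; apply/eqP.
  case: (ltngtP b b') => // lt.
    have : h * b.+1 <= h * b' by rewrite leq_mul2l lt orbT.
    by rewrite mulnS; lia.
  have : h * b'.+1 <= h * b by rewrite leq_mul2l lt orbT.
  by rewrite mulnS; lia.
- move=> b bN le; apply: allpairs_f; rewrite mem_iota /=; last first.
    by rewrite add0n ltnS leq_div2r.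
  have : (X + h * b) %/ P <= (X + P) %/ P.
    apply: leq_div2r; rewrite leq_add2l; apply: leq_trans hP.
    by rewrite leq_mul2l ltnW ?orbT ?codes_lt.
  by rewrite [(X + P) %/ P]divnDr // divnn P0; lia.
Qed.

(* Cauchy-Schwarz over the fibres of [phi] and [psi]. *)
Lemma coincidences_le (r1 r2 : seq nat) (phi psi : nat -> nat) J :
  (forall a, phi a < J) ->
  \sum_(a <- r1) \sum_(b <- r2) (phi a == psi b) <=
  \sum_(a <- r1) \sum_(a' <- r1) (phi a == phi a') +
  \sum_(b <- r2) \sum_(b' <- r2) (psi b == psi b').
Proof.
move=> phiJ.
(* Pairs are sorted by their common value [j]. The factor [f a < J] discards values outside the
   range, which [psi] may take. *)
have fib (r r' : seq nat) (f g : nat -> nat) :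
    \sum_(j < J) (\sum_(a <- r) (f a == j)) * (\sum_(b <- r') (g b == j)) =
    \sum_(a <- r) \sum_(b <- r') (f a == g b) * (f a < J).
  transitivity (\sum_(j < J) \sum_(a <- r) \sum_(b <- r') (f a == j) * (g b == j)).
    by apply: eq_bigr => j _; rewrite big_distrlr.
  rewrite exchange_big; apply: eq_bigr => a _.
  rewrite exchange_big; apply: eq_bigr => b _ /=.
  case: ltnP => [faJ | Jfa].
    rewrite (bigD1 (Ordinal faJ)) //= eqxx mul1n eq_sym big1 ?addn0 ?muln1 // => j /negPf nj.
    suff -> : (f a == j) = false by [].
    by rewrite eq_sym; apply: contraFF nj => /eqP e; apply/eqP/val_inj.
  rewrite muln0 big1 // => j _.
  suff -> : (f a == j) = false by [].
  by apply/eqP => e; move: (ltn_ord j); rewrite -e ltnNge Jfa.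
have E1 (r : seq nat) (g : nat -> nat) : \sum_(a <- r1) \sum_(b <- r) (phi a == g b) =
    \sum_(j < J) (\sum_(a <- r1) (phi a == j)) * (\sum_(b <- r) (g b == j)).
  by rewrite fib; apply: eq_bigr => a _; apply: eq_bigr => b _; rewrite phiJ muln1.
rewrite !E1.
apply: (@leq_trans (\sum_(j < J) (\sum_(a <- r1) (phi a == j)) * (\sum_(b <- r1) (phi b == j))
  + \sum_(j < J) (\sum_(a <- r2) (psi a == j)) * (\sum_(b <- r2) (psi b == j)))).
  (* In each fibre this is [x * y <= x * x + y * y]. *)
  rewrite -big_split; apply: leq_sum => j _ /=; nia.
rewrite leq_add2l fib; apply: leq_sum => a _; apply: leq_sum => b _.
by case: (_ == _) (_ < _) => [] [].
Qed.

(** * The order of 2 modulo powers of 3 *)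

(** Since 4^e = 3e + 1 modulo 9, the hypothesis forces e = 3e'. With 4^e' = 3y + 1, the cube minus
    one is 3 * 3y * (3(y^2 + y) + 1), whose last factor is prime to 3, so exactly one factor 3 is
    lost in passing from e to e'. *)
Lemma dvdn_exp4_sub1 q e : 3 ^ q.+1 %| 4 ^ e - 1 -> 3 ^ q %| e.
Proof.
elim: q e => [|q IH] e; first by rewrite expn0 dvd1n.
move=> dv.
have e3 : 3 %| e.
  have: 4 ^ e = 3 * e + 1 %[mod 9].
    elim: e {dv} => [//|e IHe]; rewrite expnS -modnMmr IHe modnMmr.
    have -> : 4 * (3 * e + 1) = e * 9 + (3 * e.+1 + 1) by lia.
    by rewrite modnMDl.
  have : 9 %| 4 ^ e - 1 by apply: dvdn_trans dv; rewrite 2!expnS mulnA dvdn_mulr.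
  by have := expn_gt0 4 e; lia.
have [e' E] : exists e', e = 3 * e' by exists (e %/ 3); rewrite mulnC divnK.
rewrite {e e3}E in dv *; rewrite expnS dvdn_pmul2l //; apply: IH.
have [y Ey] : exists y, 4 ^ e' = 3 * y + 1.
  exists ((4 ^ e').-1 %/ 3); suff : 4 ^ e' %% 3 = 1 by lia.
  by rewrite -modnXm exp1n.
move: dv; rewrite mulnC expnM Ey.
have -> : (3 * y + 1) ^ 3 - 1 = 3 * (3 * y * (3 * (y ^ 2 + y) + 1)) by rewrite !expnS !expn0; lia.
rewrite expnS dvdn_pmul2l // Gauss_dvdl ?addnK //.
by rewrite coprimeXl // /coprime mulnC gcdnMDl.
Qed.

(** Reduction modulo 3 makes the exponent even, and then 2^d is a power of 4. *)
Lemma dvdn_exp2_sub1 q d : 3 ^ q.+1 %| 2 ^ d - 1 -> 2 * 3 ^ q %| d.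
Proof.
move=> dv.
have d2 : 2 %| d.
  have h : forall e, 2 ^ e %% 3 = if odd e then 2 else 1.
    by elim=> // e IHe; rewrite expnS -modnMmr IHe /=; case: (odd e).
  have : 3 %| 2 ^ d - 1 by apply: dvdn_trans dv; rewrite expnS dvdn_mulr.
  rewrite dvdn2; have := h d; have := expn_gt0 2 d; case: (odd d); lia.
have [e E] : exists e, d = 2 * e by exists (d %/ 2); rewrite mulnC divnK.
by move: dv; rewrite E expnM dvdn_pmul2l //; apply: dvdn_exp4_sub1.
Qed.

(* Over one period of 2 modulo 3 ^ q.+1 the map is injective in n. *)
Lemma count_period q b K w n0 : coprime 3 b ->
  \sum_(n0 <= n < n0 + 2 * 3 ^ q) ((2 ^ n.+1 * b + K) %% 3 ^ q.+1 <= w) <= w.+1.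
Proof.
move=> cb; rewrite -[w.+1](size_iota 0).
pose f n := (2 ^ n.+1 * b + K) %% 3 ^ q.+1.
apply: (@leq_count_inj _ (fun n => f n <= w) _ f); first exact: iota_uniq.
- move=> n n'; rewrite !mem_filter !mem_index_iota => /andP[_ nI] /andP[_ n'I].
  wlog le : n n' nI n'I / n <= n' => [hw E|].
    by case/orP: (leq_total n n') => le; [|symmetry]; apply: hw.
  move=> /eqP; rewrite /f eqn_modDr eq_sym eqn_mod_dvd; last first.
    by rewrite leq_mul2r leq_exp2l // ltnS le orbT.
  rewrite -mulnBl Gauss_dvdl ?coprimeXl //.
  have -> : 2 ^ n'.+1 - 2 ^ n.+1 = 2 ^ n.+1 * (2 ^ (n' - n) - 1).
    by rewrite mulnBr muln1 -expnD addSn subnKC.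
  rewrite Gauss_dvdr ?coprimeXl ?coprimeXr // => /dvdn_exp2_sub1 dv.
  have [|lt] := posnP (n' - n); first lia.
  by have := dvdn_leq lt dv; lia.
- by move=> n _ le; rewrite mem_iota.
Qed.

Lemma count_periods q b K w n0 c : coprime 3 b ->
  \sum_(n0 <= n < n0 + 2 * 3 ^ q * c) ((2 ^ n.+1 * b + K) %% 3 ^ q.+1 <= w)
    <= w.+1 * c.
Proof.
move=> cb; elim: c => [|c IH]; first by rewrite !muln0 addn0 big_geq.
rewrite !mulnS [w.+1 + _]addnC [2 * 3 ^ q + _]addnC.
rewrite (@big_cat_nat _ _ _ (n0 + 2 * 3 ^ q * c)) /= ?leq_addr //; last lia.
apply: leq_add => //.
by rewrite addnA; exact: count_period.
Qed.

(** * Collisions of truncations, averaged over n *)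

(* The s-digit ternary truncation of the fractional part of h * a / 3 ^ Q. *)
Definition cell (s Q h a : nat) : nat := (h * a %/ 3 ^ (Q - s)) %% 3 ^ s.

(** The diagonal is included, so this is the sum of the squared fibre sizes of [cell], the quantity
    that Cauchy-Schwarz produces. *)
Definition collisions (m s Q n : nat) : nat :=
  \sum_(a <- codes m) \sum_(a' <- codes m)
    (cell s Q (2 ^ n.+1) a == cell s Q (2 ^ n.+1) a').

(** Equal cells put h(a - a') within 3^(Q-s) of a multiple of 3^Q; adding 3^(Q-s) moves this
    two-sided window to one starting at 0. *)
Lemma cell_eq_window s Q h a a' : s <= Q -> a' <= a ->
  cell s Q h a = cell s Q h a' ->
  (h * (a - a') + 3 ^ (Q - s)) %% 3 ^ Q <= 2 * 3 ^ (Q - s).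
Proof.
rewrite /cell => sQ le /eqP.
have -> : 3 ^ Q = 3 ^ s * 3 ^ (Q - s) by rewrite -expnD subnKC.
have : 0 < 3 ^ (Q - s) by rewrite expn_gt0.
move: (3 ^ (Q - s)) (3 ^ s) => c P c0.
have leh : h * a' <= h * a by rewrite leq_mul2l le orbT.
rewrite eqn_mod_dvd ?leq_div2r // => /dvdnP[k Ek].
have := divn_eq (h * a) c; have := divn_eq (h * a') c.
have := ltn_pmod (h * a) c0; have := ltn_pmod (h * a') c0.
have : h * a' %/ c <= h * a %/ c by rewrite leq_div2r.
rewrite mulnBr; move: (h * a %/ c) (h * a' %/ c) ((h * a) %% c) ((h * a') %% c) Ek.
move: (h * a) (h * a') leh => A A' leh x x' r r' Ek lex r'c rc EA' EA.
have -> : A - A' + c = k * (P * c) + (r + c - r').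
  have Ex : x = x' + k * P by lia.
  by move: leh; rewrite EA EA' Ex !mulnDl mulnA; move: (x' * c) (k * P * c); lia.
by rewrite modnMDl; apply: leq_trans (leq_mod _ _) _; lia.
Qed.

(** Write d = 3^v b with b prime to 3. Dividing by 3^v leaves the modulus 3^(Q-v), for which the
    range of n consists of 3^v c full periods. As v < m, the assumption s + m <= Q keeps the scaled
    half-width 3^(Q-v-s) a positive integer, so that 2 * 3^(Q-v-s) + 1 is at most 3 * 3^(Q-v-s). *)
Lemma count_window_d s m Q d n0 c : 0 < d < 3 ^ m -> s + m <= Q ->
  \sum_(n0 <= n < n0 + 2 * 3 ^ Q.-1 * c)
    ((2 ^ n.+1 * d + 3 ^ (Q - s)) %% 3 ^ Q <= 2 * 3 ^ (Q - s))
  <= 3 * 3 ^ (Q - s) * c.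
Proof.
move=> /andP[d0 dm] smQ.
have [b cb Ed] := pfactor_coprime (isT : prime 3) d0.
set v := logn 3 d in Ed.
have vm : v < m.
  rewrite -(@ltn_exp2l 3) //; apply: leq_ltn_trans dm; rewrite Ed leq_pmull //.
  by case: b cb {Ed} => //; rewrite /coprime.
have [q Eq] : exists q, Q = v + q.+1 by exists (Q - v).-1; lia.
have sq : s <= q.+1 by lia.
have EQs : 3 ^ (Q - s) = 3 ^ v * 3 ^ (q.+1 - s) by rewrite -expnD; congr (_ ^ _); lia.
have -> : 2 * 3 ^ Q.-1 * c = 2 * 3 ^ q * (3 ^ v * c).
  by rewrite Eq addnS /= expnD; lia.
rewrite (eq_bigr (fun n => nat_of_bool
    ((2 ^ n.+1 * b + 3 ^ (q.+1 - s)) %% 3 ^ q.+1 <= 2 * 3 ^ (q.+1 - s)))); last first.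
  move=> n _; congr nat_of_bool; rewrite EQs Eq Ed expnD.
  rewrite [b * _]mulnC mulnCA -mulnDr -muln_modr [2 * (_ * _)]mulnCA leq_pmul2l //.
  by rewrite expn_gt0.
apply: leq_trans (count_periods _ _ _ _ _ cb) _.
rewrite EQs [X in _ <= X](_ : _ = 3 * 3 ^ (q.+1 - s) * (3 ^ v * c)); last lia.
by rewrite leq_mul2r; have := expn_gt0 3 (q.+1 - s); lia.
Qed.

Lemma sum_diag_codes m : \sum_(a <- codes m) \sum_(a' <- codes m) (a == a') = 2 ^ m.
Proof.
rewrite -size_codes -sum1_size big_seq [RHS]big_seq; apply: eq_bigr => a am.
by rewrite (eq_bigr (fun a' => if a' == a then 1 else 0)) -?big_mkcond ?sum1_count
  ?(count_uniq_mem _ (codes_uniq m)) ?am // => a' _; rewrite eq_sym; case: eqP.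
Qed.

(** The first term comes from the 2^m diagonal pairs, which collide for every n; the second bounds
    each of the at most 4^m other pairs by [count_window_d]. *)
Lemma sum_collisions m s Q n0 c : s + m <= Q ->
  \sum_(n0 <= n < n0 + 2 * 3 ^ Q.-1 * c) collisions m s Q n <=
  2 ^ m * (2 * 3 ^ Q.-1 * c) + 4 ^ m * (3 * 3 ^ (Q - s) * c).
Proof.
move=> smQ; set len := 2 * 3 ^ Q.-1 * c; set C := 3 * 3 ^ (Q - s) * c.
rewrite /collisions exchange_big /=.
apply: (@leq_trans (\sum_(a <- codes m) \sum_(a' <- codes m) ((a == a') * len + C))).
  rewrite big_seq [leqRHS]big_seq; apply: leq_sum => a am.
  rewrite exchange_big /= big_seq [leqRHS]big_seq; apply: leq_sum => a' a'm.
  have [<-|aa'] := eqVneq a a'.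
    rewrite mul1n (eq_bigr (fun=> 1)) => [|n _]; last by rewrite eqxx.
    by rewrite sum_nat_const_nat muln1 addKn leq_addr.
  rewrite mul0n add0n.
  wlog lt : a a' am a'm aa' / a' < a => [hw|].
    case: (ltngtP a a') aa' => // lt _; last by apply: hw => //; rewrite neq_ltn lt orbT.
    under eq_bigr do rewrite eq_sym.
    by apply: hw => //; rewrite neq_ltn lt orbT.
  have d0 : 0 < a - a' < 3 ^ m by have := codes_lt am; lia.
  apply: leq_trans (count_window_d n0 c d0 smQ); apply: leq_sum => n _.
  case: eqP => // /cell_eq_window -> //; lia.
under eq_bigr do rewrite big_split /= -big_distrl /=.
rewrite big_split /= -big_distrl /= sum_diag_codes leq_add2l.
under eq_bigr do rewrite big_const_seq count_predT iter_addn_0 size_codes.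
rewrite big_const_seq count_predT iter_addn_0 size_codes -mulnA -expnMn.
by rewrite mulnC.
Qed.

(** * Counting the codes that hit a window *)

(** After division by c the window covers at most w + 3 residues r modulo P. For each r the
    condition is an equality between a function of a and a function of b, and [coincidences_le]
    applies. *)
Lemma coincidences_mod (r1 r2 : seq nat) (x1 x2 : nat -> nat) P c w Z :
  0 < P -> 0 < c ->
  \sum_(a <- r1) \sum_(b <- r2) ((x1 a + x2 b + Z) %% (P * c) <= w * c) <=
  w.+3 * (\sum_(a <- r1) \sum_(a' <- r1) ((x1 a %/ c) %% P == (x1 a' %/ c) %% P) +
          \sum_(b <- r2) \sum_(b' <- r2) ((x2 b %/ c) %% P == (x2 b' %/ c) %% P)).
Proof.
(* Splitting the quotient of a sum of three terms loses at most two carries; the 2 turns this loss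
   into a surplus between 0 and 2. *)
move=> P0 c0; pose Y b := x2 b %/ c + (Z %/ c + 2).
apply: (@leq_trans (\sum_(r < w.+3) \sum_(a <- r1) \sum_(b <- r2)
    (* [P - Y b %% P] represents minus [Y b] modulo [P] within the naturals. *)
    ((x1 a %/ c) %% P == (r + (P - Y b %% P)) %% P))).
  rewrite [leqRHS]exchange_big; apply: leq_sum => a _ /=.
  rewrite [leqRHS]exchange_big; apply: leq_sum => b _ /=.
  case le: (_ %% _ <= w * c) => //.
  set S := x1 a %/ c + Y b.
  have ltr : S %% P < w.+3.
    have [th Eth th2] : exists2 th, (x1 a + x2 b + Z) %/ c + th = S & th <= 2.
      have h x y : exists2 t, (x + y) %/ c + t = x %/ c + y %/ c + 1 & t <= 1.
        have := divnD x y c0; case: (_ <= _) => ->; [exists 0 | exists 1]; lia.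
      have [t Et t1] := h (x1 a) (x2 b).
      have [t' Et' t'1] := h (x1 a + x2 b) Z.
      exists (t + t'); last by rewrite (leq_add t1 t'1).
      have aux A B C D E : B + t = C + D + 1 -> A + t' = B + E + 1 ->
        A + (t + t') = C + (D + (E + 2)) by clear; lia.
      exact: aux Et Et'.
    rewrite -Eth -modnDml; apply: leq_ltn_trans (leq_mod _ _) _.
    rewrite -addn2 -addSn leq_add // ltnS.
    by rewrite modn_divl -(mulnK w c0) leq_div2r.
  rewrite (bigD1 (Ordinal ltr)) //= /S modnDml -addnA.
  suff -> : (x1 a %/ c + (Y b + (P - Y b %% P))) %% P = (x1 a %/ c) %% P by rewrite eqxx.
  have -> : Y b + (P - Y b %% P) = (Y b %/ P).+1 * P.
    have := divn_eq (Y b) P; have := ltn_pmod (Y b) P0; rewrite mulSn.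
    by move: (Y b %/ P * P); lia.
  by rewrite addnC modnMDl.
rewrite -[w.+3 in leqRHS]card_ord -sum_nat_const; apply: leq_sum => r _.
apply: leq_trans (@coincidences_le _ _ (fun a => (x1 a %/ c) %% P)
  (fun b => (r + (P - Y b %% P)) %% P) P _) _; first by move=> a; rewrite ltn_pmod.
rewrite leq_add2l; apply: leq_sum => b _; apply: leq_sum => b' _.
case: eqP => // /eqP; rewrite eqn_modDl => /eqP E.
suff : (Y b) %% P = (Y b') %% P by rewrite /Y => /eqP; rewrite eqn_modDr => ->.
have := ltn_pmod (Y b) P0; have := ltn_pmod (Y b') P0.
move: (Y b %% P) (Y b' %% P) E => u u' E u'P uP.
have : P - u + (u + u') = P - u' + (u + u') %[mod P] by rewrite -modnDml E modnDml.
have -> : P - u + (u + u') = P + u' by lia.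
have -> : P - u' + (u + u') = P + u by lia.
by rewrite !modnDl !modn_small.
Qed.

(** The first 2s and the last e digits are summed trivially, which gives 2^(2s+e). The two middle
    blocks are the pair for [coincidences_mod] with w = 6, whence 9 = 6 + 3. *)
Lemma count_prefixes s e n Z :
  \sum_(b <- codes (6 * s + e)) ((2 ^ n.+1 * b + Z) %% 3 ^ (6 * s + e) <= 6 * 3 ^ (5 * s + e))
  <= 9 * 2 ^ (2 * s + e) *
     (collisions (2 * s) s (4 * s) n + collisions (2 * s) s (6 * s) n).
Proof.
have E6 : 6 * s + e = 2 * s + (2 * s + (2 * s + e)) by lia.
rewrite {1}E6 sum_codesD.
set E := collisions _ _ _ _ + _; set h := 2 ^ n.+1.
have bound X : \sum_(b1 <- codes (2 * s + (2 * s + e)))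
    ((h * b1 + X) %% 3 ^ (6 * s + e) <= 6 * 3 ^ (5 * s + e)) <= 2 ^ e * (9 * E).
  rewrite sum_codesD.
  under eq_bigr do rewrite sum_codesD.
  under eq_bigr do rewrite exchange_big /=.
  rewrite exchange_big /= -size_codes.
  have -> : size (codes e) * (9 * E) = \sum_(b <- codes e) 9 * E.
    by rewrite big_const_seq count_predT iter_addn_0 mulnC.
  apply: leq_sum => b3 _.
  (* Over the common denominator 3^(6s+e), the truncation of a block ending at position Q is its
     [cell]. *)
  have dv Q x : s <= Q <= 6 * s ->
      (h * x * 3 ^ (6 * s + e - Q)) %/ 3 ^ (5 * s + e) = h * x %/ 3 ^ (Q - s).
    move=> Qs.
    have -> : 3 ^ (5 * s + e) = 3 ^ (Q - s) * 3 ^ (6 * s + e - Q).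
      by rewrite -expnD; congr (_ ^ _); lia.
    by rewrite divnMr // expn_gt0.
  have := @coincidences_mod (codes (2 * s)) (codes (2 * s))
    (fun a => h * a * 3 ^ (6 * s + e - 4 * s)) (fun a => h * a * 3 ^ (6 * s + e - 6 * s))
    (3 ^ s) (3 ^ (5 * s + e)) 6 (h * b3 + X).
  rewrite !expn_gt0 => /(_ isT isT) key.
  apply: leq_trans (leq_trans _ key) _.
    apply: leq_sum => a1 _; apply: leq_sum => a2 _.
    have -> : 3 ^ s * 3 ^ (5 * s + e) = 3 ^ (6 * s + e).
      by rewrite -expnD; congr (_ ^ _); lia.
    have -> : 6 * s + e - 4 * s = 2 * s + e by lia.
    have -> : 6 * s + e - 6 * s = e by lia.
    by rewrite !mulnDr !mulnA !addnA.
  rewrite leq_mul2l /= /E /collisions /cell -/h; apply: eq_leq; congr (_ + _);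
    apply: eq_bigr => a _; apply: eq_bigr => b _; rewrite !dv //; lia.
apply: (@leq_trans (\sum_(b <- codes (2 * s)) 2 ^ e * (9 * E))).
  apply: leq_sum => b0 _.
  apply: leq_trans (bound (h * (b0 * 3 ^ (2 * s + (2 * s + e))) + Z)).
  by apply: leq_sum => b1 _; rewrite mulnDr -addnA addnCA.
by rewrite big_const_seq count_predT iter_addn_0 size_codes expnD; lia.
Qed.

(** A hit forces the prefix [b'] into the window of [count_prefixes], and each such prefix has at
    most 14 tails by [count_codes_window]. *)
Lemma count_hits s e n Z : 0 < s ->
  2 ^ n <= 3 ^ (5 * s + e) -> 3 ^ (5 * s + e) <= 3 * 2 ^ n ->
  \sum_(b <- codes (6 * s + e + 8 * s))
    ((2 ^ n.+1 * b + Z) %% 3 ^ (6 * s + e + 8 * s) <= 4 * 3 ^ (5 * s + e))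
  <= 14 * (9 * 2 ^ (2 * s + e) *
     (collisions (2 * s) s (4 * s) n + collisions (2 * s) s (6 * s) n)).
Proof.
move=> s0 le1 le2; rewrite sum_codesD expnD.
set h := 2 ^ n.+1; have Eh : h = 2 * 2 ^ n by rewrite /h expnS.
have h0 : 0 < h by rewrite expn_gt0.
set T := 3 ^ (8 * s); have T0 : 0 < T by rewrite expn_gt0.
set D := 3 ^ (5 * s + e) in le1 le2 *.
have DP : 3 ^ (6 * s + e) = 3 ^ s * D by rewrite -expnD; congr (_ ^ _); lia.
(* As h <= 2D and a tail is below T, [H] bounds the contribution of every tail. Adding [H] to the
   offset leaves the nonnegative slack [H - h * b], and 4D + H <= 6DT gives the prefix window 6D. *)
pose H := 2 * D * T.
apply: leq_trans (leq_mul (leqnn 14) (count_prefixes s e n ((Z + H) %/ T))).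
rewrite big_distrr /=; apply: leq_sum => b' _; rewrite -/h -/D.
case: (boolP ((h * b' + (Z + H) %/ T) %% 3 ^ (6 * s + e) <= 6 * D)) => [_|nprefix].
  rewrite muln1; apply: (@leq_trans (2 * (4 * D %/ h).+1)).
    rewrite (eq_bigr (fun b => nat_of_bool
      ((h * (b' * T) + Z + h * b) %% (3 ^ (6 * s + e) * T) <= 4 * D))); last first.
      by move=> b _; rewrite mulnDr addnAC.
    apply: count_codes_window => //; rewrite -/T leq_mul2r; apply/orP; right.
    have s3 : 3 <= 3 ^ s by rewrite -{1}[3]expn1 leq_exp2l.
    by rewrite DP; apply: leq_trans (leq_mul s3 (leqnn D)); lia.
  (* From D <= 3 * 2^n one gets 4D <= 6h, whence 14 = 2 * (6 + 1). *)
  suff : 4 * D %/ h <= 6 by lia.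
  by rewrite -[6](mulnK 6 h0) leq_div2r //; lia.
rewrite muln0 leqn0 big_seq big1 // => b bT; apply/eqP; rewrite eqb0.
apply: contra nprefix => hit.
have hb : h * b <= H.
  apply: (@leq_trans (h * T)); first by rewrite leq_mul2l ltnW ?orbT ?codes_lt.
  by rewrite leq_mul2r Eh leq_mul2l le1 !orbT.
have -> : h * b' + (Z + H) %/ T = (h * (b' * T) + (Z + H)) %/ T.
  by rewrite mulnA divnMDl.
rewrite modn_divl -(mulnK (6 * D) T0) leq_div2r //.
have -> : h * (b' * T) + (Z + H) = (h * (b' * T + b) + Z) + (H - h * b).
  by rewrite mulnDr; move: hb; move: (h * b) (h * (b' * T)) H; clear; lia.
rewrite -modnDml; apply: leq_trans (leq_mod _ _) _.
apply: (@leq_trans (4 * D + H)); first by rewrite leq_add // leq_subr.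
have : D <= D * T by rewrite leq_pmulr.
by rewrite /H; lia.
Qed.

(** Because 729 = 3^6, the block length 728 * 3^(6s) is a multiple of the period 2 * 3^(Q-1) for Q =
    4s and Q = 6s. Diagonal pairs give 728 * 12^s * 243^s, the others 3276 * 16^s * 243^s; 12^s <=
    16^s and 728 + 3276 = 4004. *)
Lemma sum_block_collisions s : 0 < s ->
  \sum_(729 ^ s <= n < 729 ^ s.+1)
    (collisions (2 * s) s (4 * s) n + collisions (2 * s) s (6 * s) n)
  <= 2 * (4004 * (16 * 243) ^ s).
Proof.
move=> s0.
have one Q : 3 * s <= Q <= 6 * s ->
  \sum_(729 ^ s <= n < 729 ^ s.+1) collisions (2 * s) s Q n <= 4004 * (16 * 243) ^ s.
  move=> Qs.
  have -> : 729 ^ s.+1 = 729 ^ s + 2 * 3 ^ Q.-1 * (1092 * 3 ^ (6 * s - Q)).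
    have : 729 ^ s = 3 * (3 ^ Q.-1 * 3 ^ (6 * s - Q)).
      rewrite -expnD -expnS -[729]/(3 ^ 6) -expnM; congr (_ ^ _); lia.
    by rewrite expnS; move: (729 ^ s) => X ->; lia.
  apply: leq_trans (sum_collisions _ _ _) _; first lia.
  have E1 : 2 * 3 ^ Q.-1 * (1092 * 3 ^ (6 * s - Q)) = 728 * (3 ^ s * 243 ^ s).
    rewrite [LHS](_ : _ = 728 * (3 * (3 ^ Q.-1 * 3 ^ (6 * s - Q)))); last lia.
    congr (_ * _); rewrite -[243]/(3 ^ 5) -expnM -!expnD -expnS; congr (_ ^ _); lia.
  have E2 : 3 * 3 ^ (Q - s) * (1092 * 3 ^ (6 * s - Q)) = 3276 * 243 ^ s.
    rewrite [LHS](_ : _ = 3276 * (3 ^ (Q - s) * 3 ^ (6 * s - Q))); last lia.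
    congr (_ * _); rewrite -[243]/(3 ^ 5) -expnM -!expnD; congr (_ ^ _); lia.
  rewrite E1 E2 !expnM -[2 ^ 2]/4 -[4 ^ 2]/16 expnMn.
  have : 4 ^ s * 3 ^ s <= 16 ^ s by rewrite -expnMn leq_exp2r.
  move=> le; have {le} := leq_mul le (leqnn (243 ^ s)).
  move: (243 ^ s) (16 ^ s) (4 ^ s) (3 ^ s) => a b c d; lia.
have h4 : 3 * s <= 4 * s <= 6 * s by rewrite !leq_mul2r !orbT.
have h6 : 3 * s <= 6 * s <= 6 * s by rewrite !leq_mul2r !orbT.
by rewrite big_split /= [2 * (4004 * _)]mul2n -addnn leq_add // one.
Qed.

Definition hit_level s n := up_log 3 (2 ^ n) + 9 * s.

Definition hits s n Z : seq nat :=
  [seq b <- codes (hit_level s n) |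
    (2 ^ n.+1 * b + Z) %% 3 ^ hit_level s n <= 4 * 3 ^ up_log 3 (2 ^ n)].

(** With l = 5s + e, the level is (2s + e) + 12s, so this is [count_hits] with 126 = 14 * 9, read as
    a proportion of all 2^L codes. *)
Lemma size_hits s n Z : 0 < s -> 729 ^ s <= n ->
  size (hits s n Z) * 2 ^ (12 * s) <= 126 * 2 ^ hit_level s n *
    (collisions (2 * s) s (4 * s) n + collisions (2 * s) s (6 * s) n).
Proof.
move=> s0 sn; rewrite /hits /hit_level; set l := up_log 3 (2 ^ n).
have le1 : 2 ^ n <= 3 ^ l by apply: up_logP.
have le2 : 3 ^ l <= 3 * 2 ^ n.
  have [n0|n0] := posnP n; first by rewrite /l n0.
  have := @up_log_bounds 3 (2 ^ n) isT _; rewrite -/l => /(_ _)/andP[].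
    by rewrite -{1}(expn0 2) ltn_exp2l.
  have l0 : 0 < l by rewrite up_log_gt0 //= -{1}(expn0 2) ltn_exp2l.
  by rewrite -{3}(prednK l0) expnS; lia.
(* This follows from 2^n <= 3^l <= 4^l and 10s <= 729^s <= n. *)
have sl : 5 * s <= l.
  have : 2 ^ n <= 2 ^ (2 * l).
    apply: leq_trans (le1) _; rewrite expnM.
    by have [->|l0] := posnP l; [|rewrite leq_exp2r].
  rewrite leq_exp2l // => n2l; suff : 10 * s <= n by lia.
  apply: leq_trans sn; rewrite -{2}(prednK s0) expnS.
  by have := @ltn_expl 729 s.-1 isT; lia.
have [e El] : exists e, l = 5 * s + e by exists (l - 5 * s); lia.
have -> : l + 9 * s = 6 * s + e + 8 * s by lia.
rewrite El in le1 le2 *.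
have := count_hits Z s0 le1 le2.
rewrite size_filter -sum1_count [X in _ -> X * _ <= _]big_mkcond /=.
rewrite [X in _ -> X * _ <= _](eq_bigr (fun b => nat_of_bool
  ((2 ^ n.+1 * b + Z) %% 3 ^ (6 * s + e + 8 * s) <= 4 * 3 ^ (5 * s + e)))); last first.
  by move=> b _; case: (_ <= _).
have -> : 2 ^ (6 * s + e + 8 * s) = 2 ^ (2 * s + e) * 2 ^ (12 * s).
  by rewrite -expnD; congr (_ ^ _); lia.
move: (2 ^ (2 * s + e)) (2 ^ (12 * s)) (\sum_(_ <- _) _) (collisions _ _ _ _ + _).
by move=> a b B E le; have := leq_mul le (leqnn b); lia.
Qed.

Local Open Scope classical_set_scope.
Local Open Scope ring_scope.

(** * Null sets for the Hausdorff measure *)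

Lemma diam_ge0 (R : realType) (U : set R) : (0 <= diam U)%E.
Proof. by apply: ereal_sup_ubound; left. Qed.

Lemma diam_set0 (R : realType) : diam (set0 : set R) = 0%E.
Proof.
apply/eqP; rewrite eq_le diam_ge0 andbT; by apply: ge_ereal_sup => z [-> //|[x []]].
Qed.

Lemma diam_pow_ge0 (R : realType) (s : R) (U : set R) : (0 <= diam_pow s U)%E.
Proof. by rewrite /diam_pow; case: ifP => // _; exact: poweR_ge0. Qed.

Lemma hausdorff_ge0 (R : realType) (s : R) (A : set R) : (0 <= hausdorff s A)%E.
Proof.
apply: le_ereal_sup_tmp; exists (hausdorff_delta s 1 A); first by exists 1 => //=.
apply: le_ereal_inf_tmp => _ [U _ <-].
by apply: nneseries_ge0 => n _ _; exact: diam_pow_ge0.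
Qed.

Lemma nneseries_nth (R : realType) (T : Type) (x0 : T) (r : seq T) (f : T -> \bar R) :
  f x0 = 0%E -> (forall x, 0 <= f x)%E ->
  (\sum_(0 <= i <oo) f (nth x0 r i) = \sum_(x <- r) f x)%E.
Proof.
move=> f0 fge; rewrite (nneseries_split 0 (size r)) // add0n.
rewrite [X in (_ + X)%E]eseries0 ?adde0 ?(big_nth x0) //.
by move=> i ri _; rewrite nth_default.
Qed.

(** A Borel-Cantelli argument: every tail of the families covers [A], and a late tail has small sets
    and small total weight. *)
Lemma hausdorff_cantelli (R : realType) (s : R) (A : set R) (cov : nat -> seq (set R)) :
  (forall delta : R, 0 < delta -> exists k0, forall k U, (k0 <= k)%N ->
     U \in cov k -> (diam U <= delta%:E)%E) ->
  (\sum_(0 <= k <oo) \sum_(U <- cov k) diam_pow s U < +oo)%E ->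
  (forall k0 x, A x -> exists k U, [/\ (k0 <= k)%N, U \in cov k & U x]) ->
  hausdorff s A = 0%E.
Proof.
move=> small summ covA; apply/eqP; rewrite eq_le hausdorff_ge0 andbT.
apply: ge_ereal_sup => _ [delta /= delta0 <-].
apply/lee_addgt0Pr => e e0; rewrite add0e.
pose w k : \bar R := (\sum_(U <- cov k) diam_pow s U)%E.
have w0 k : (0 <= w k)%E by apply: sume_ge0 => U _; exact: diam_pow_ge0.
have [k1 k1P] := small _ delta0.
have [k0 k01 tail] : exists2 k0, (k1 <= k0)%N & (\sum_(k0 <= k <oo) w k <= e%:E)%E.
  have /fine_cvgP[fin] := nneseries_tail_cvg summ (fun k _ => w0 k).
  move/cvgrPdist_le => /(_ e e0) near.
  have [N _ NP] := filterI fin near.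
  exists (maxn k1 N); first exact: leq_maxl.
  have [/= finN] := NP (maxn k1 N) (leq_maxr _ _).
  rewrite sub0r normrN /= => le.
  by rewrite -(fineK finN) lee_fin (le_trans (ler_norm _) le).
have /card_set_bijP[f fbij] : ([set: nat] #= [set: nat * nat])%card.
  by rewrite card_eq_sym; exact: card_nat2.
(* The finite lists are padded with empty sets, which weigh 0, and a bijection of nat with nat * nat
   turns the double family into one sequence. *)
pose V (p : nat * nat) := nth set0 (cov (p.1 + k0)%N) p.2.
have dp0 : diam_pow s (set0 : set R) = 0%E by rewrite /diam_pow eqxx.
apply: ge_ereal_inf; exists (\sum_(0 <= i <oo) diam_pow s (V (f i)))%E.
  exists (V \o f) => //; split=> [i|x Ax] /=.
    rewrite /V; set r := cov _.
    have [lt|ge] := ltnP (f i).2 (size r).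
      by apply: (k1P ((f i).1 + k0)%N); [rewrite (leq_trans k01) ?leq_addl|exact: mem_nth].
    by rewrite nth_default // diam_set0 lee_fin ltW.
  have [k [U [k0k Uk Ux]]] := covA k0 x Ax.
  have [_ _ /(_ (k - k0, index U (cov k))%N I)[i _ fi]] := fbij.
  by exists i => //; rewrite /= fi /V /= subnK // nth_index.
rewrite nneseries_esumT; last by move=> i; exact: diam_pow_ge0.
rewrite -(reindex_esum _ _ f (fun p => diam_pow s (V p)) fbij).
have -> : [set: nat * nat] = [set: nat] `*`` (fun=> [set: nat]).
  by apply/seteqP; split => p.
rewrite -(esum_esum (a := fun k j => diam_pow s (V (k, j)))); last first.
  by move=> *; exact: diam_pow_ge0.
apply: le_trans tail.
rewrite -(nneseries_addn _ w0) nneseries_esumT //.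
apply: le_esum => k _; rewrite -nneseries_esumT /V /=; last first.
  by move=> j; exact: diam_pow_ge0.
by rewrite nneseries_nth // => U; exact: diam_pow_ge0.
Qed.

(** * Covering the limsup set *)

Lemma powR3_cantor_dim (R : realType) : 3 `^ cantor_dim R = 2.
Proof.
have ln3 : ln (3 : R) != 0 by rewrite gt_eqF // ln_gt0 // ltr1n.
by rewrite /powR pnatr_eq0 /= /cantor_dim divfK // lnK // posrE.
Qed.

Lemma cantor_dim_gt0 (R : realType) : 0 < cantor_dim R.
Proof. by rewrite divr_gt0 // ln_gt0 // ltr1n. Qed.

Lemma expr3_cantor_dim (R : realType) (L : nat) :
  (3 ^- L) `^ cantor_dim R = 2 ^- L.
Proof.
have h : (0 : R) <= 3 by [].
rewrite -powR_invn // -powRrM mulrC powRrM powR3_cantor_dim powR_invn //.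
Qed.

(* 3 ^ 7 > 2 ^ 11 *)
Lemma inv_cantor_dim_ge (R : realType) : 11 / 7 <= (cantor_dim R)^-1.
Proof.
have l2 : 0 < ln (2 : R) by rewrite ln_gt0 // ltr1n.
rewrite /cantor_dim invf_div ler_pdivlMr //.
have : ln ((2 : R) ^+ 11) <= ln (3 ^+ 7).
  by rewrite ler_ln ?posrE ?exprn_gt0 // -!natrX ler_nat.
by rewrite !lnXn // -[ln 2 *+ 11]mulr_natl -[ln 3 *+ 7]mulr_natl; lra.
Qed.

Definition ternary_itv (R : realType) (L b : nat) : set R :=
  [set x | (2 * b)%:R <= 3 ^+ L * x <= (2 * b + 1)%:R].

Lemma diam_ternary_itv (R : realType) (L b : nat) :
  (diam (ternary_itv L b : set R) <= (3 ^- L)%:E)%E.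
Proof.
apply: ge_ereal_sup => z [->|[x /= /andP[x1 x2] [x' /andP[x'1 x'2] <-]]].
  by rewrite lee_fin invr_ge0 exprn_ge0.
have P3 : (0 : R) < 3 ^+ L by rewrite exprn_gt0.
rewrite lee_fin -[_^-1]mul1r ler_pdivlMr // -[X in _ * X]gtr0_norm // -normrM.
rewrite mulrBl ![_ * 3 ^+ L]mulrC; move: x1 x2 x'1 x'2; rewrite natrD => *.
by rewrite ler_norml; apply/andP; split; lra.
Qed.

Lemma diam_pow_ternary_itv (R : realType) (L b : nat) :
  (diam_pow (cantor_dim R) (ternary_itv L b) <= (2 ^- L)%:E)%E.
Proof.
rewrite /diam_pow; case: ifP => _; first by rewrite lee_fin invr_ge0 exprn_ge0.
rewrite -expr3_cantor_dim -poweR_EFin; apply: gt0_ler_poweR.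
- exact/ltW/cantor_dim_gt0.
- by rewrite in_itv /= diam_ge0 leey.
- by rewrite in_itv /= lee_fin invr_ge0 exprn_ge0 //= leey.
- exact: diam_ternary_itv.
Qed.

(** The partial sum S L is the left endpoint, with b given by the halved digits. The bounds S k +
    3^-k decrease, so the remaining digits add at most 3^-L. *)
Lemma cantor_set_prefix (R : realType) (x : R) (L : nat) :
  cantor_set R x -> exists2 b, b \in codes L & ternary_itv L b x.
Proof.
move=> [_ [d [d02 dx]]]; set S := series _ in dx.
have SS k : S k.+1 = S k + (d k)%:R / 3 ^+ k.+1 by rewrite /S seriesSr.
have P3 k : (0 : R) < 3 ^+ k by rewrite exprn_gt0.
have d2 k : (d k)%:R / 3 ^+ k.+1 + 3 ^- k.+1 <= 3 ^- k :> R.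
  have -> : 3 ^- k = 3 / 3 ^+ k.+1 :> R by rewrite exprS; field; rewrite gt_eqF.
  rewrite -[X in _ + X]mul1r -mulrDl ler_pM2r ?invr_gt0 // natr1 ler_nat.
  by case: (d02 k) => ->.
have Snd : {homo S : m n / (m <= n)%N >-> m <= n}.
  apply/nondecreasing_seqP => k; rewrite SS lerDl divr_ge0 // ltW //.
have Sni : {homo (fun k => S k + 3 ^- k) : m n / (m <= n)%N >-> n <= m}.
  by apply/nonincreasing_seqP => k; rewrite SS -addrA lerD2l.
have lim_x : lim (S @ \oo) = x by apply/cvg_lim.
have cvS : cvgn S by apply/cvg_ex; exists x.
have lo : S L <= x by rewrite -lim_x; apply: nondecreasing_cvgn_le.
have hi : x <= S L + 3 ^- L.
  rewrite -lim_x; apply: limr_le => //; near=> k.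
  apply: (@le_trans _ _ (S k + 3 ^- k)); first by rewrite lerDl invr_ge0 ltW.
  by apply: Sni; near: k; exact: nbhs_infty_ge.
suff [b bL Eb] : exists2 b, b \in codes L & 3 ^+ L * S L = (2 * b)%:R.
  exists b => //; rewrite /ternary_itv /= natrD -Eb ler_pM2l // lo /=.
  by apply: le_trans (_ : 3 ^+ L * (S L + 3 ^- L) <= _); rewrite ?ler_pM2l // mulrDr mulfV ?gt_eqF.
elim: L {lo hi} => [|L [b bL Eb]].
  by exists 0%N => //; rewrite /S /series /= big_geq // mulr0 muln0.
exists (3 * b + d L %/ 2)%N.
  by apply: codesS_mem => //; case: (d02 L) => ->.
rewrite SS exprS mulrDr -[3 * _ * S L]mulrA Eb mulrCA mulfV ?mulr1; last first.
  by rewrite -exprS gt_eqF.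
rewrite -natrM -natrD; congr (_%:R); case: (d02 L) => ->; lia.
Unshelve. all: by end_near. Qed.

(* Translates the window around 3 ^ L * y to one starting at 0. *)
Definition hit_offset (R : realType) (y : R) (s n : nat) : nat :=
  absz (modz ((2 * 3 ^ up_log 3 (2 ^ n))%N%:Z - Num.floor (3 ^+ hit_level s n * y))
             (3 ^ hit_level s n)%N%:Z).

Lemma mem_hits (R : realType) (x y : R) (s n b : nat) :
  b \in codes (hit_level s n) -> ternary_itv (hit_level s n) b x ->
  dist_int (2 ^+ n * x - y) < 3 ^- (9 * s) ->
  b \in hits s n (hit_offset y s n).
Proof.
rewrite /hits mem_filter /hit_offset => -> + + /[!andbT].
set L := hit_level s n; set l := up_log 3 (2 ^ n).
move=> /andP[X1 X2] /inf_lt[]; first by exists `|2 ^+ n * x - y - 0%:~R|, 0.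
move=> _ [k _ <-] near.
set F := Num.floor _; have /andP[F1 F2] := floor_itv (3 ^+ L * y); rewrite -/F in F1 F2.
pose v : int := (2 ^ n.+1 * b)%N%:Z - (3 ^ L)%N%:Z * k - F + (2 * 3 ^ l)%N%:Z.
(* The distance to the integer, the position of x in its interval and the rounding of 3^L y each
   cost at most 3^l. The first acts in both directions, the second only downwards, the third only
   upwards, so the shift 2 * 3^l gives a value in [0, 4 * 3^l]. *)
have [v0 v1] : 0 <= v /\ v <= (4 * 3 ^ l)%N%:Z.
  have D2 : (2 : R) ^+ n <= 3 ^+ l by rewrite -!natrX ler_nat up_logP.
  have D1 : (1 : R) <= 3 ^+ l by rewrite exprn_ege1 // ler1n.
  have P3 : (0 : R) < 3 ^+ L by rewrite exprn_gt0.
  have {}near : `|2 ^+ n * (3 ^+ L * x) - 3 ^+ L * y - 3 ^+ L * k%:~R| < 3 ^+ l.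
    have -> : 2 ^+ n * (3 ^+ L * x) - 3 ^+ L * y - 3 ^+ L * k%:~R
      = 3 ^+ L * (2 ^+ n * x - y - k%:~R) by ring.
    rewrite normrM gtr0_norm // mulrC -ltr_pdivlMr //; apply: lt_le_trans near _.
    rewrite /L /hit_level -/l exprD invfM mulrA mulfV ?mul1r //.
  have E : v%:~R = 2 ^+ n * (2 * b)%:R - 3 ^+ L * k%:~R - F%:~R + 2 * 3 ^+ l :> R.
    by rewrite /v !(rmorphD, rmorphN, rmorphM) /= -!pmulrn !(natrM, natrX) exprS; ring.
  have Y1 : 2 ^+ n * (2 * b)%:R <= 2 ^+ n * (3 ^+ L * x).
    by rewrite ler_pM2l ?exprn_gt0.
  have Y2 : 2 ^+ n * (3 ^+ L * x) <= 2 ^+ n * (2 * b)%:R + 2 ^+ n.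
    rewrite -[X in _ <= _ + X]mulr1 -mulrDr ler_pM2l ?exprn_gt0 //.
    by move: X2; rewrite natrD.
  rewrite intrD in F2; move: near; rewrite ltr_norml => /andP[n1 n2].
  split; rewrite -(ler_int R) E -?pmulrn ?natrM ?natrX; move: Y1 Y2; rewrite natrM; lra.
have [v' Ev] : exists v', v = Posz v' by exists `|v|%N; rewrite gez0_abs.
apply: (@leq_trans (v' %% 3 ^ L)%N); last first.
  by apply: leq_trans (leq_mod _ _) _; move: v1; rewrite Ev.
apply: eq_leq; apply/eqP; rewrite -eqz_nat -!modz_nat -Ev PoszD gez0_abs; last first.
  by rewrite modz_ge0 // eqz_nat -lt0n expn_gt0.
rewrite modzDmr; have -> : v = - k * (3 ^ L)%N%:Z +
  ((2 ^ n.+1 * b)%N%:Z + ((2 * 3 ^ l)%N%:Z - F)) by rewrite /v; ring.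
by rewrite modzMDl.
Qed.

Lemma psi_le (R : realType) (tau : R) (s n : nat) : 3 / 2 <= tau ->
  (729 ^ s <= n)%N -> psi tau n <= 3 ^- (9 * s).
Proof.
move=> tau32 sn; rewrite /psi.
have n1 : 1 <= n%:R :> R by rewrite ler1n (leq_trans _ sn) // expn_gt0.
apply: (@le_trans _ _ (n%:R `^ (- (3 / 2)))); first by apply: ler_powR => //; lra.
have n0 : 0 < n%:R :> R by lra.
have pn : n%:R `^ (3 / 2) \is @Num.pos R by rewrite posrE powR_gt0.
have p3 : (3 : R) ^+ (9 * s) \is @Num.pos R by rewrite posrE exprn_gt0.
rewrite powRN (lef_pV2 pn p3).
have -> : 3 ^+ (9 * s) = (729 ^ s)%:R `^ (3 / 2) :> R.
  have -> : (729 ^ s)%:R = 3 `^ (6 * s)%:R :> R.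
    by rewrite powR_mulrn // exprM natrX; congr (_ ^+ _); ring.
  by rewrite -powRrM -powR_mulrn //; congr (_ `^ _); rewrite !natrM; field.
apply: ge0_ler_powR; first by rewrite divr_ge0.
- by rewrite nnegrE ler0n.
- by rewrite nnegrE ltW.
- by rewrite ler_nat.
Qed.

(** The block s = 0 is left empty because the counting bounds assume s > 0; only late blocks have to
    cover. *)
Definition hit_cover (R : realType) (y : R) (s : nat) : seq (set R) :=
  if s == 0%N then [::] else
  flatten [seq [seq ternary_itv (hit_level s n) b | b <- hits s n (hit_offset y s n)]
          | n <- index_iota (729 ^ s) (729 ^ s.+1)].

(** The weight 2^-L of an interval cancels the 2^L in [size_hits], and the ratio is 16 * 243 / 2^12
    = 243/256. *)
Lemma sum_hit_cover (R : realType) (y : R) :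
  exists2 C : R, 0 <= C & forall s,
    (\sum_(U <- hit_cover y s) diam_pow (cantor_dim R) U
      <= (C * (243 / 256) ^+ s)%:E)%E.
Proof.
have [c block] : exists c, forall s, (0 < s)%N ->
    (126 * \sum_(729 ^ s <= n < 729 ^ s.+1)
      (collisions (2 * s) s (4 * s) n + collisions (2 * s) s (6 * s) n)
    <= c * (16 * 243) ^ s)%N.
  exists (126 * 2 * 4004)%N => s s0; rewrite -!mulnA leq_mul2l.
  by rewrite sum_block_collisions ?orbT.
exists c%:R => // s; rewrite /hit_cover; have [->|s0] := posnP s.
  by rewrite big_nil lee_fin expr0 mulr1 ler0n.
rewrite big_flatten big_map.
pose E n := (collisions (2 * s) s (4 * s) n + collisions (2 * s) s (6 * s) n)%N.
apply: (@le_trans _ _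
    (\sum_(729 ^ s <= n < 729 ^ s.+1) (126 * (E n)%:R / 2 ^+ (12 * s))%:E)%E).
  rewrite big_seq [leRHS]big_seq; apply: lee_sum => n.
  rewrite mem_index_iota => /andP[sn _]; rewrite big_map.
  apply: (@le_trans _ _
      (\sum_(b <- hits s n (hit_offset y s n)) (2 ^- hit_level s n)%:E)%E).
    by apply: lee_sum => b _; exact: diam_pow_ternary_itv.
  rewrite sumEFin big_const_seq count_predT iter_addr_0 lee_fin -[leLHS]mulr_natl.
  rewrite ler_pdivlMr ?exprn_gt0 // mulrAC ler_pdivrMr ?exprn_gt0 //.
  have := size_hits (hit_offset y s n) s0 sn; rewrite -/(E n).
  rewrite -(ler_nat R) !natrM !natrX.
  by rewrite [126 * 2 ^+ _ * _]mulrAC.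
rewrite sumEFin lee_fin -mulr_suml -mulr_sumr -natr_sum ler_pdivrMr ?exprn_gt0 //.
rewrite -natrM -mulrA exprM -exprMn.
have -> : 243 / 256 * 2 ^+ 12 = (16 * 243)%:R :> R by rewrite natrM; field.
by rewrite -natrX -natrM ler_nat; exact: block.
Qed.

Lemma nneseries_geometric_lty (R : realType) (C q : R) : 0 <= C -> 0 < q < 1 ->
  (\sum_(0 <= k <oo) (C * q ^+ k)%:E < +oo)%E.
Proof.
move=> C0 /andP[q0 q1].
apply: (@le_lt_trans _ _ (C / (1 - q))%:E); last exact: ltry.
apply: lime_le.
  by apply: is_cvg_nneseries => k _ _; rewrite lee_fin mulr_ge0 // exprn_ge0 // ltW.
near=> n; rewrite sumEFin lee_fin.
by have := @geometric_le_lim R n C q C0 q0; rewrite gtr0_norm //; apply.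
Unshelve. all: by end_near. Qed.

Lemma infinite_set_nat_ge (A : set nat) (N : nat) :
  infinite_set A -> exists2 n, A n & (N <= n)%N.
Proof.
move=> /infinite_setD/(_ (finite_II N))/infinite_setN0[n [An /negP]].
by rewrite -leqNgt; exists n.
Qed.

Theorem theorem1p2 (R : realType) (tau y : R) (tau_ge0 : 0 <= tau)
    (tau_ge : (cantor_dim R)^-1 - 1 / 100 <= tau) :
  cantor_measure (W2 (psi tau) y) = 0%E.
Proof.
(* Here 11/7 - 1/100 exceeds 3/2. *)
have tau32 : 3 / 2 <= tau by have := inv_cantor_dim_ge R; lra.
apply: (@hausdorff_cantelli _ _ _ (hit_cover y)).
(* The chain is 1/delta <= s <= 3^s <= 3^L. *)
- move=> delta delta0; exists (Num.truncn delta^-1).+1 => s U ks.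
  rewrite /hit_cover gtn_eqF; last exact: leq_trans ks.
  move=> /flatten_mapP[n _ /mapP[b _ ->]].
  apply: le_trans (diam_ternary_itv _ _ _) _.
  rewrite lee_fin -[delta]invrK lef_pV2 ?posrE ?exprn_gt0 ?invr_gt0 //.
  apply: (@le_trans _ _ s%:R).
    by apply/ltW/(lt_le_trans (truncnS_gt _)); rewrite ler_nat.
  rewrite -natrX ler_nat; apply: leq_trans (ltnW (@ltn_expl 3 s isT)) _.
  by rewrite leq_exp2l // /hit_level; lia.
- have [C C0 le] := sum_hit_cover y.
  apply: le_lt_trans (@nneseries_geometric_lty R C (243 / 256) C0 _); last lra.
  by apply: lee_nneseries => [k _ _|k _ //]; apply: sume_ge0 => U _; exact: diam_pow_ge0.
- move=> k0 x [Wx Kx].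
  (* Taking n >= 729^(k0+1) puts n in a block s > k0, so s is also nonzero. *)
  have [n [n0 near] kn] := infinite_set_nat_ge (729 ^ k0.+1) Wx.
  have /andP[sn ns] := trunc_log_bounds (isT : 1 < 729)%N n0.
  set s := trunc_log 729 n in sn ns.
  have k0s : (k0 < s)%N by apply: trunc_log_max.
  have [b bL bx] := cantor_set_prefix (hit_level s n) Kx.
  exists s, (ternary_itv (hit_level s n) b); split=> //; first exact: ltnW.
  rewrite /hit_cover gtn_eqF; last exact: leq_trans k0s.
  apply/flatten_mapP; exists n; first by rewrite mem_index_iota sn.
  apply/map_f/(mem_hits bL bx)/(lt_le_trans near)/psi_le => //.
Qed.
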